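(* Let $n_0=2^{r_0}\cdot3^{\epsilon_0}\cdot p_1\cdots p_{k_0}$, where $r_0,k_0\ge0$ are integers, $\epsilon_0\in\{0,1,2\}$, and $p_1,\dots,p_{k_0}\ge5$ are distinct primes. Suppose that there do not exist finite groups $G,N$ of order $n_0$ with $G$ insolvable, $N$ solvable and $\mathcal{E}'(G,N)\neq\emptyset$. Assume moreover: 1. every subgroup of index a power of two of any insolvable group of order $n_0$ is insolvable; 2. there is no non-abelian simple group of order $2^r\cdot n_0$ for any integer $r\ge1$; 3. if $n_0$ is even, then $n_0/2$ is a solvable number; 4. for every odd prime $p$ dividing $n_0$ and every integer $r\ge0$, the number $(2^r\cdot n_0)/p$ is solvable. Then for every integer $r\ge1$, there do not exist finite groups $G,N$ of order $2^r\cdot n_0$ with $G$ insolvable, $N$ solvable and $\mathcal{E}'(G,N)\neq\emptyset$.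
   Context: A positive integer $n$ is called solvable if every group of order $n$ is solvable. For a finite group $N$, let $\mathrm{Perm}(N)$ be the group of all permutations of the set $N$. A subgroup $\mathcal{G}\le \mathrm{Perm}(N)$ is regular if the map $\mathcal{G}\to N$, $\sigma\mapsto\sigma(1_N)$, is bijective. Let $\rho:N\to\mathrm{Perm}(N)$, $\rho(\eta)(x)=x\eta^{-1}$. The holomorph of $N$ is $\mathrm{Hol}(N)=\rho(N)\rtimes\mathrm{Aut}(N)\le\mathrm{Perm}(N)$. For a group $G$ with $|G|=|N|$, $\mathcal{E}'(G,N)$ denotes the set of regular subgroups of $\mathrm{Hol}(N)$ isomorphic to $G$. *)

(* Defs.v *)
From mathcomp Require Import all_boot all_fingroup all_solvable.
Set Implicit Arguments. Unset Strict Implicit. Unset Printing Implicit Defensive.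
Local Open Scope group_scope.

Definition solvable_number (n : nat) : Prop :=
  forall (gT : finGroupType) (G : {group gT}), #|G| = n -> solvable G.

Definition rho (nT : finGroupType) (eta : nT) : {perm nT} :=
  perm (mulIg eta^-1).

Definition Hol (nT : finGroupType) : {set {perm nT}} :=
  [set rho eta | eta : nT] * Aut [set: nT].

Definition regular (nT : finGroupType) (H : {set {perm nT}}) : Prop :=
  {in H &, injective (fun s : {perm nT} => s 1)} /\
  (forall x : nT, exists2 s, s \in H & s 1 = x).

(* E'(G, N) is nonempty, N being the whole group nT. *)
Definition Eprime_nonempty (gT nT : finGroupType) (G : {group gT}) : Prop :=
  exists H : {group {perm nT}}, [/\ H \subset Hol nT, regular H & G \isog H].

(* Main.v *)
(** A regular subgroup of Hol(N) amounts to a second complement of Aut(N) in the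
    semidirect product N * Aut(N). More flexibly, consider N, A, X with A
    normalising N, N A = X A and N, X both meeting A trivially. If M is
    characteristic in N, Dedekind's law shows that M, A, X :&: M A is again such
    a triple, with #|X :&: M A| = #|M|. Suppose N is solvable of order 2^r n0 and
    X is not solvable; take M maximal among the proper characteristic subgroups
    of N, so that N / M is elementary abelian of order p^m, and put
    Y := X :&: M A. If Y is insolvable then #|Y| = 2^s n0 with s < r by the
    hypotheses on orders, which induction on r excludes. So Y is solvable. For
    p = 2, Y has 2-power index in X, and subgroups of 2-power index of
    insolvable groups of order 2^r n0 are insolvable: none of these groups is
    simple, and a proper normal subgroup or its quotient is insolvable of
    smaller order 2^s n0. For p odd, the shape of n0 forces #|N / M| = p or 9,
    so Aut(N / M) is solvable; the part of X centralising N / M is solvable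
    because modulo M its derived subgroup lies in A. *)
Require Import Defs.
From mathcomp Require Import all_boot all_fingroup all_solvable.
From mathcomp Require Import all_algebra mxrepresentation mxabelem integral_char.
Local Open Scope group_scope.

(** * Regular pairs and characteristic subgroups *)

(* [X] acts regularly on the right cosets of [A] in [N * A], i.e. on [N]. *)
Definition regular_pair {gT : finGroupType} (N A X : {group gT}) : Prop :=
  [/\ A \subset 'N(N), N :&: A = 1, X :&: A = 1 & X * A = N * A].

Lemma regular_pair_card {gT : finGroupType} {N A X : {group gT}} :
  regular_pair N A X -> #|X| = #|N|.
Proof.
case=> _ tiNA tiXA defXA; apply/eqP; rewrite -(eqn_pmul2r (cardG_gt0 A)).
by rewrite -!TI_cardMg // defXA.
Qed.

Lemma regular_pair_char {gT : finGroupType} {N A X M : {group gT}} :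
  M \char N -> regular_pair N A X -> regular_pair M A (X :&: (M <*> A)).
Proof.
move=> chM [nNA tiNA tiXA defXA].
have sMN := char_sub chM; have nMA := char_norm_trans chM nNA.
split=> //.
- by apply/trivgP; rewrite -tiNA setSI.
- by apply/trivgP; rewrite -tiXA setSI ?subsetIl.
rewrite /= setIC group_modr ?joing_subr // defXA.
have defMA : M <*> A = M * A by apply: norm_joinEr.
by rewrite -defMA; apply/setIidPl; rewrite /= defMA mulSg.
Qed.

(** * Regular pairs versus regular subgroups of the holomorph *)

(** Right multiplication by [x = m x * a x] on the cosets of [A] becomes, on the transversal [N],
    the map from [y] to [(y * m x) ^ a x]: a translation followed by an automorphism, hence an
    element of the holomorph. *)
Lemma regular_pair_Eprime {gT : finGroupType} {N A X : {group gT}} :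
  regular_pair N A X -> Eprime_nonempty (subg_of N : finGroupType) X.
Proof.
move=> rNAX; have [nNA tiNA tiXA defXA] := rNAX.
have sXNA: X \subset N * A by rewrite -defXA mulG_subl.
pose m x := divgr N A x; pose a x := remgr N A x.
have Nm x : x \in X -> m x \in N by move/(subsetP sXNA)/mem_divgr.
have Aa x : x \in X -> a x \in A by move/(subsetP sXNA)/mem_remgr.
have nNa x : x \in X -> a x \in 'N(N) by move/Aa/(subsetP nNA).
have defX x : x = m x * a x by apply: divgr_eq.
(* [a] is the projection of the semidirect product onto [A], with kernel [N]. *)
have aM : {in X &, {morph a : x y / x * y}}.
  have cNA: A \in [complements to N in N <*> A].
    by rewrite inE tiNA norm_joinEr ?eqxx.
  have sXJ: X \subset N <*> A by rewrite norm_joinEr.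
  move=> x y Xx Xy; rewrite /a (remgrM cNA) ?(subsetP sXJ) //.
  by rewrite /normal joing_subl join_subG normG.
clearbody m a.
pose al x := Aut_isom (injm_subg N) (subxx N) (conj_aut N (a x)).
pose s x := rho (subg N (m x))^-1 * al x.
(* The image of [y] is the representative in [N] of the coset [A :* (y * x)]. *)
have sE x y : x \in X -> s x y = subg N ((a x)^-1 * (sgval y * x)).
  move=> Xx; have Ny := subgP y.
  rewrite /s permM permE invgK -{1}(sgvalK y) -morphM ?Nm //.
  rewrite Aut_isomE ?groupM ?Nm //; last first.
    have := subsetP (Aut_conj_aut N A) (conj_aut N (a x)); apply.
    by rewrite mem_morphim ?nNa ?Aa.
  congr (subg N _); rewrite norm_conj_autE ?nNa ?groupM ?Nm // {4}[x]defX.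
  by rewrite conjgE !mulgA.
have Nsx x y : x \in X -> y \in N -> (a x)^-1 * (y * x) \in N.
  move=> Xx Ny; rewrite {2}[x]defX (mulgA y) -conjgE memJ_norm ?nNa //.
  by rewrite groupM ?Nm.
have sM : {in X &, {morph s : x y / x * y}}.
  move=> x y Xx Xy; apply/permP=> z; rewrite permM !sE ?groupM //.
  rewrite subgK ?Nsx ?subgP // aM // invMg.
  by congr (subg N _); rewrite !mulgA.
pose f := Morphism sM.
(* The stabiliser of 1 is [X :&: A], which is trivial. *)
have s1 x : x \in X -> s x 1 = 1 -> x = 1.
  move=> Xx; rewrite sE // mul1g => /(congr1 sgval).
  rewrite subgK; last by rewrite -{2}(mul1g x) Nsx.
  rewrite morph1 => /(congr1 (fun z => a x * z)); rewrite mulKVg mulg1 => eq_xa.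
  by apply/set1gP; rewrite -tiXA inE Xx eq_xa Aa.
have injf : 'injm f.
  apply/subsetP=> x /morphpreP[Xx /set1gP fx1]; rewrite inE.
  by apply/eqP/s1; rewrite //= -[s x]/(f x) fx1 perm1.
have im1 : {in f @* X &, injective (fun t : {perm subg_of N} => t 1)}.
  move=> t u Xt Xu /= eq_tu; apply/eqP; rewrite eq_mulgV1; apply/eqP.
  have: t * u^-1 \in f @* X by rewrite groupM ?groupV.
  case/morphimP=> x _ Xx def_x; rewrite def_x /=; have -> : x = 1.
    by apply: s1; rewrite // -[s x]/(f x) -def_x permM eq_tu permK.
  exact: (morph1 f).
exists (f @* X)%G; split; last by rewrite sub_isog.
  apply/subsetP=> _ /morphimP[x _ Xx ->]; apply: mem_mulg; first exact: imset_f.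
  by rewrite -im_subg Aut_Aut_isom.
split=> // y; have: y \in [set: [subg N]] by rewrite inE.
suff <- : [set (t : {perm subg_of N}) 1 | t in f @* X] = [set: [subg N]].
  by case/imsetP=> t Xt ->; exists t.
apply/eqP; rewrite eqEcard subsetT card_in_imset //= card_injm //.
by rewrite (regular_pair_card rNAX) (card_isog (isog_subg N)).
Qed.

(** Take for [N] the right translations and for [A] the automorphisms; these fix 1, so regularity of
    [X] makes [X :&: A] trivial, and counting gives [X * A = N * A]. *)
Lemma Eprime_regular_pair {gT nT : finGroupType} {G : {group gT}} :
  Eprime_nonempty nT G ->
  exists N A X : {group {perm nT}},
    [/\ regular_pair N A X, [set: nT] \isog N & G \isog X].
Proof.
case=> X [sX [injX surX] isoGX].
(* Permutations compose from left to right, so [rho] itself reverses products; the inverse repairs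
   this. *)
pose f (x : nT) := rho x^-1.
have fM : {in [set: nT] &, {morph f : x y / x * y}}.
  by move=> x y _ _; apply/permP=> z; rewrite permM !permE /= !invgK mulgA.
pose F := Morphism fM.
have imF : F @* [set: nT] = [set rho eta | eta : nT].
  rewrite morphimEdom; apply/setP=> u; apply/imsetP/imsetP=> [] [x _ ->].
    by exists x^-1.
  by exists x^-1; rewrite //= /f invgK.
have injF : 'injm F.
  apply/injmP=> x y _ _ /(congr1 (fun s : {perm nT} => s 1)).
  by rewrite !permE !mul1g !invgK.
exists (F @* [set: nT])%G, (Aut [set: nT])%G, X.
have HolE : Hol nT = F @* [set: nT] * Aut [set: nT] by rewrite /Hol imF.
have Aut1 (s : {perm nT}) : s \in Aut [set: nT] -> s 1 = 1.
  by move=> As; apply: (morph1 (autm_morphism As)).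
have tiXA : X :&: Aut [set: nT] = 1.
  apply/trivgP/subsetP=> s /setIP[Xs /Aut1 s1]; rewrite inE; apply/eqP.
  by apply: injX => //; rewrite s1 perm1.
have tiNA : F @* [set: nT] :&: Aut [set: nT] = 1.
  apply/trivgP/subsetP=> _ /setIP[/morphimP[x _ _ ->] /Aut1 s1]; rewrite inE.
  by move: s1; rewrite permE mul1g invgK => ->; rewrite morph1.
have nNA : Aut [set: nT] \subset 'N(F @* [set: nT]).
  apply/subsetP=> b Ab; rewrite inE; apply/subsetP=> _ /imsetP[_ /morphimP[x _ _ ->] ->].
  suff ->: F x ^ b = F (b x) by rewrite mem_morphim ?inE.
  apply/permP=> z; rewrite -(permKV b z) permJ !permE !invgK.
  by apply: (morphM (autm_morphism Ab)); rewrite inE.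
have cardX : #|X| = #|nT|.
  rewrite -(card_in_imset injX) -cardsT; congr #|pred_of_set _|.
  apply/setP=> x; rewrite inE; apply/imsetP; have [s Xs <-] := surX x.
  by exists s.
split=> //; last by rewrite sub_isog.
split=> //; apply/eqP; rewrite eqEcard.
rewrite !TI_cardMg // card_injm // cardsT cardX leqnn andbT.
by rewrite -(norm_joinEr nNA) mul_subG ?joing_subr //= (norm_joinEr nNA) -HolE.
Qed.

(** * Solvability of [X] from its action on an abelian section *)

Lemma abelian_complement_sol {gT : finGroupType} {N A X : {group gT}} :
  abelian N -> A \subset 'N(N) -> X \subset N * A ->
  solvable (X / 'C_X(N)) -> solvable (X :&: A) -> solvable X.
Proof.
move=> abN nNA sX solXC solXA.
have nNX : X \subset 'N(N).
  by apply: subset_trans sX _; rewrite mul_subG ?normG.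
have nCX : 'C_X(N) <| X by rewrite /normal subsetIl normsI ?normG ?norms_cent.
rewrite (series_sol nCX) solXC andbT.
have sC : 'C_X(N) \subset N <*> 'C_A(N).
  rewrite cent_joinEr ?subsetIr // group_modl //.
  by rewrite setSI.
have nCC : 'C_X(N)^`(1) <| 'C_X(N) by apply: der_normal.
rewrite (series_sol nCC) (abelian_sol (der_abelian 0 _)) andbT.
apply: solvableS solXA; rewrite subsetI (subset_trans (der_sub 1 _)) ?subsetIl //=.
apply: subset_trans (dergS 1 sC) _.
have /der_cprod : N \* 'C_A(N) = N <*> 'C_A(N).
  by rewrite cprodEY // subsetIr.
move/(_ 1%N)/cprodW <-; rewrite mul_subG //; last first.
  exact: subset_trans (der_sub 1 _) (subsetIl _ _).
by move/derG1P: abN => ->; apply: sub1G.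
Qed.

Lemma sol_quotient_cent_cyclic {gT : finGroupType} {N X : {group gT}} :
  cyclic N -> X \subset 'N(N) -> solvable (X / 'C_X(N)).
Proof.
move=> cycN nNX; apply: abelian_sol.
have := first_isog_loc (conj_aut_morphism N) nNX.
rewrite /= ker_conj_aut => /isog_abelian ->.
by apply: abelianS (Aut_conj_aut N X) _; apply: Aut_cyclic_abelian.
Qed.

(** The quotient embeds in GL(2, 3), of order 48; only the primes 2 and 3 divide its order, so
    Burnside's theorem applies. *)
Lemma sol_quotient_cent_9 {gT : finGroupType} {N X : {group gT}} :
  3.-abelem N -> #|N| = 9 -> X \subset 'N(N) -> solvable (X / 'C_X(N)).
Proof.
move=> abN oN nNX.
have ntN : N != 1 :> {set gT} by rewrite -cardG_gt1 oN.
pose f := reprGL_morphism (abelem_repr abN ntN nNX).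
have := first_isog_loc f (subxx X).
rewrite ker_reprGLm rker_abelem setIA setIid => /isog_sol ->.
apply: Burnside_p_a_q_b.
have dvd48 : #|f @* X| %| 48.
  apply: dvdn_trans (cardSg (subsetT (f @* X)%G)) _ => /=.
  have -> : #|[set: {'GL_('dim N)['F_3]}]| = 48; last exact: dvdnn.
  rewrite card_GL // (_ : 'dim N = 2); last by rewrite /abelem_dim' oN.
  by rewrite card_Fp // big_ltn // big_nat1.

apply: (@uniq_leq_size _ _ (primes 48)) (primes_uniq _) _ => p.
by rewrite !mem_primes => /and3P[-> _ /dvdn_trans->].
Qed.

(** [M :&: X] lies in the solvable group [X :&: (M <*> A)], whose image modulo [M] is the
    intersection of [X / M] and [A / M]; this reduces to the abelian case for [N / M]. *)
Lemma regular_pair_sol {gT : finGroupType} {N A X M : {group gT}} :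
    M \char N -> abelian (N / M) -> regular_pair N A X ->
    solvable (X :&: (M <*> A)) ->
    solvable ((X / M) / 'C_(X / M)(N / M)) ->
  solvable X.
Proof.
move=> chM abNM [nNA _ _ defXA] solXMA solXC.
have nMA := char_norm_trans chM nNA; have nMN := char_norm chM.
have sXNA : X \subset N * A by rewrite -defXA mulG_subl.
have nMX : X \subset 'N(M) by apply: subset_trans sXNA _; rewrite mul_subG.
have nMX' : M :&: X <| X by rewrite /normal subsetIr normsI ?normG.
rewrite (series_sol nMX') (isog_sol (second_isog nMX)); apply/andP; split.
  apply: solvableS solXMA; rewrite subsetI subsetIr.
  by apply: subset_trans (subsetIl _ _) _; apply: joing_subl.
apply: abelian_complement_sol abNM (quotient_norms _ nNA) _ solXC _.
  by rewrite -quotientMl // quotientS.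
rewrite /= -(quotientYidl nMA) setIC -quotientGI ?joing_subl //= setIC.
exact: quotient_sol.
Qed.

(** * Maximal characteristic subgroups *)

(** For [M] maximal among proper characteristic subgroups, [N / M] is characteristically simple,
    because characteristic subgroups lift; being solvable, it is elementary abelian. The exponent
    [m.+1] records that it is nontrivial. *)
Lemma max_char_abelem {gT : finGroupType} {N : {group gT}} :
    solvable N -> N :!=: 1 ->
  exists (M : {group gT}) (p m : nat),
    [/\ M \char N, prime p, p.-abelem (N / M) & #|N / M| = (p ^ m.+1)%N].
Proof.
move=> solN ntN; pose P (M : {group gT}) := (M \char N) && (M \proper N).
have [|M /maxgroupP[/andP[chM prM] maxM] _] := @maxgroup_exists _ P 1%G.
  by rewrite /P char1 proper1G ntN.
have nMN := char_norm chM; have nsMN := char_normal chM.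
have ntNM : N / M != 1.
  by rewrite -subG1 quotient_sub1 // (proper_subn prM).
have simNM : charsimple (N / M).
  apply/charsimpleP; split=> // K ntK chK.
  have [L defK sML sLN] := inv_quotientS nsMN (char_sub chK).
  have nsML : M <| L by rewrite /normal sML (subset_trans sLN).
  have chL : L \char N by apply: char_from_quotient nsML chM _; rewrite -defK.
  suff eqLN : L :=: N by apply/val_inj; rewrite /= defK eqLN.
  apply/eqP; rewrite eqEsubset sLN /=; apply: contraNT ntK => nsNL.
  rewrite defK (maxM L) ?trivg_quotient //.
  by rewrite /P chL properE sLN.
have /is_abelemP[p p_pr abNM] := charsimple_solvable simNM (quotient_sol _ solN).
have oNM := card_pgroup (abelem_pgroup abNM).
exists M, p, (logn p #|N / M|).-1; split=> //.
rewrite prednK // lt0n; apply: contra ntNM => /eqP lg0.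
by rewrite trivg_card1 oNM lg0.
Qed.

(** * Orders of insolvable groups *)

Lemma solvable_number_dvdn {n d : nat} :
  n > 0 -> d %| n -> solvable_number n -> solvable_number d.
Proof.
move=> n_gt0 /dvdnP[q defn] soln gT G oG.
have q_gt0 : q > 0 by move: n_gt0; rewrite defn; case: q {defn}.
(* Enlarge [G] to order [n] by a cyclic direct factor. *)
pose Q := [set: 'I_q.-1.+1].
have oGQ : #|setX G Q| = n.
  by rewrite cardsX cardsT card_ord prednK // oG defn mulnC.
have := soln _ (setX_group G [set: 'I_q.-1.+1]%G) oGQ.
rewrite -(injm_sol (injm_pairg1 gT 'I_q.-1.+1) (subsetT G)); apply: solvableS.
by rewrite /= morphim_pairg1 setXS ?sub1G.
Qed.

Lemma logn_prod_uniq {p : nat} {ps : seq nat} :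
  prime p -> all prime ps -> uniq ps ->
  logn p (\prod_(q <- ps) q)%N = (p \in ps).
Proof.
move=> p_pr; elim: ps => [|q ps IHps] /=; first by rewrite big_nil logn1.
move=> /andP[q_pr ps_pr] /andP[q_notin uniq_ps].
have prod_gt0 : (0 < \prod_(i <- ps) i)%N.
  by rewrite big_seq; apply: prodn_cond_gt0 => i /(allP ps_pr)/prime_gt0.
rewrite big_cons lognM ?(prime_gt0 q_pr) // IHps // logn_prime // in_cons eq_sym.
by case: eqP => // <-; rewrite (negPf q_notin).
Qed.

(* An odd prime in the index would make #|G| divide a solvable number, and so
   would a power of 2 larger than [2 ^ r]. *)
Lemma insolvable_card_dvd {n0 r : nat} {gT : finGroupType} {G : {group gT}} :
    (0 < n0)%N ->
    (~~ odd n0 -> solvable_number (n0 %/ 2)) ->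
    (forall p r, prime p -> odd p -> p %| n0 ->
       solvable_number ((2 ^ r * n0) %/ p)%N) ->
    #|G| %| (2 ^ r * n0)%N -> ~~ solvable G ->
  exists2 s, s <= r & #|G| = (2 ^ s * n0)%N.
Proof.
move=> n0_gt0 sol_half sol_div dvdG nsolG.
have not_dvd n : (0 < n)%N -> solvable_number n -> #|G| %| n -> False.
  by move=> n_gt0 soln dG; case/negP: nsolG; apply: (solvable_number_dvdn n_gt0 dG).
have n_gt0 : (0 < 2 ^ r * n0)%N by rewrite muln_gt0 expn_gt0.
have [q defn] := dvdnP dvdG.
have q_gt0 : (0 < q)%N by move: n_gt0; rewrite defn; case: q {defn}.
have /p_natP[t defq] : 2.-nat q.
  apply/pnatP=> // p p_pr p_q; rewrite inE; have [-> // | odd_p] := even_prime p_pr.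
  have p_n : p %| (2 ^ r * n0)%N by rewrite defn dvdn_mulr.
  have p_n0 : p %| n0.
    by move: p_n; rewrite Gauss_dvdr // coprime_sym coprimeXl // coprime2n.
  case: (not_dvd _ _ (sol_div p r p_pr odd_p p_n0)).
    by rewrite divn_gt0 ?prime_gt0 // dvdn_leq.
  by rewrite defn -(divnK p_q) mulnAC mulnK ?prime_gt0 // dvdn_mull.
have [le_tr | lt_rt] := leqP t r.
  exists (r - t); first exact: leq_subr.
  apply/eqP; rewrite -(eqn_pmul2l q_gt0) -defn {1}defq mulnA -expnD.
  by rewrite subnKC.
have defn0 : n0 = (2 ^ (t - r) * #|G|)%N.
  apply/eqP; rewrite -(@eqn_pmul2l (2 ^ r)) ?expn_gt0 // mulnA -expnD.
  by rewrite subnKC ?(ltnW lt_rt) // defn defq.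
have even_n0 : 2 %| n0 by rewrite defn0 dvdn_mulr // dvdn_exp ?subn_gt0.
have odd_n0 : ~~ odd n0 by rewrite -dvdn2.
case: (not_dvd _ _ (sol_half odd_n0)).
  by rewrite divn_gt0 // dvdn_leq.
rewrite defn0 -(subnSK lt_rt) expnS -mulnA mulKn //.
by rewrite dvdn_mull.
Qed.

(** * Subgroups of 2-power index *)

Lemma insolvable_two_power_index {n0 : nat} :
    (0 < n0)%N ->
    (forall (gT : finGroupType) (G H : {group gT}),
      #|G| = n0 -> ~~ solvable G -> H \subset G ->
      (exists k, #|G : H| = (2 ^ k)%N) -> ~~ solvable H) ->
    (forall r, 1 <= r -> forall (gT : finGroupType) (G : {group gT}),
      #|G| = (2 ^ r * n0)%N -> ~ (simple G /\ ~~ abelian G)) ->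
    (~~ odd n0 -> solvable_number (n0 %/ 2)) ->
    (forall p r, prime p -> odd p -> p %| n0 ->
      solvable_number ((2 ^ r * n0) %/ p)%N) ->
  forall r (gT : finGroupType) (G H : {group gT}),
    #|G| = (2 ^ r * n0)%N -> ~~ solvable G -> H \subset G ->
    2.-nat #|G : H| -> ~~ solvable H.
Proof.
move=> n0_gt0 indexP not_simple sol_half sol_div.
elim/ltn_ind=> r IHr gT G H oG nsolG sHG iGH.
case: (posnP r) => [r0 | r_gt0].
  have /p_natP[k defk] := iGH.
  by apply: (indexP _ G H) => //; [rewrite oG r0 mul1n | exists k].
have ntG : G :!=: 1 by apply: contraNneq nsolG => ->; apply: solvable1.
have [K nsKG [ntK neKG]] : exists2 K : {group gT}, K <| G & K :!=: 1 /\ K :!=: G.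
  case: (boolP [exists K : {group gT}, [&& K <| G, K :!=: 1 & K :!=: G]]).
    by case/existsP=> K /and3P[]; exists K.
  move/existsPn=> noK; case: (not_simple r r_gt0 gT G oG); split; last first.
    by apply: contra nsolG; apply: abelian_sol.
  apply/simpleP; split=> // K nsKG; move: (noK K); rewrite nsKG /= negb_and !negbK.
  by case/orP=> /eqP; [left | right].
have [sKG nKG] := andP nsKG.
(* The index of [H] in [G] is the product of those of [H / K] in [G / K] and of [K :&: H] in [K], so
   both factors are powers of two. *)
have iKH := index_quotient_ker sHG nKG.
have [solK | nsolK] := boolP (solvable K); last first.
  have dvdK : #|K| %| (2 ^ r * n0)%N by rewrite -oG cardSg.
  have [s le_sr oK] := insolvable_card_dvd n0_gt0 sol_half sol_div dvdK nsolK.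
  have ltKG : #|K| < #|G| by rewrite proper_card // properEneq neKG.
  have lt_sr : (s < r)%N by move: ltKG; rewrite oK oG ltn_pmul2r // ltn_exp2l.
  have: ~~ solvable (K :&: H).
    apply: (IHr s lt_sr _ K (K :&: H)%G) => //; first exact: subsetIl.
    rewrite indexgI; apply: pnat_dvd iGH; rewrite -iKH (setIidPr sKG).
    exact: dvdn_mull.
  by apply: contra; apply: solvableS; apply: subsetIr.
have nsolGK : ~~ solvable (G / K).
  by apply: contra nsolG => solGK; rewrite (series_sol nsKG) solK.
have oGK := card_quotient nKG.
have dvdGK : #|G / K| %| (2 ^ r * n0)%N by rewrite -oG oGK dvdn_indexg.
have [s le_sr oGK'] := insolvable_card_dvd n0_gt0 sol_half sol_div dvdGK nsolGK.
have lt_sr : (s < r)%N.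
  have: #|G / K| < #|G| by rewrite ltn_quotient.
  by rewrite oGK' oG ltn_pmul2r // ltn_exp2l.
have: ~~ solvable (H / K).
  apply: (IHr s lt_sr _ (G / K)%G (H / K)%G) => //; first exact: quotientS.
  by apply: pnat_dvd iGH; rewrite -iKH dvdn_mulr.
by apply: contra; apply: quotient_sol.
Qed.

(** * Induction on the power of two *)

Theorem theorem5p1 (n0 r0 e0 : nat) (ps : seq nat)
  (He0 : e0 <= 2) (Hps : all (fun p => prime p && (5 <= p)) ps) (Huniq : uniq ps)
  (Hn0 : n0 = (2 ^ r0 * 3 ^ e0 * \prod_(p <- ps) p)%N)
  (Hbase : ~ exists (gT nT : finGroupType) (G : {group gT}),
      [/\ #|G| = n0, #|nT| = n0, ~~ solvable G, solvable [set: nT]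
        & Eprime_nonempty nT G])
  (H1 : forall (gT : finGroupType) (G H : {group gT}),
      #|G| = n0 -> ~~ solvable G -> H \subset G ->
      (exists k, #|G : H| = (2 ^ k)%N) -> ~~ solvable H)
  (H2 : forall r, 1 <= r -> forall (gT : finGroupType) (G : {group gT}),
      #|G| = (2 ^ r * n0)%N -> ~ (simple G /\ ~~ abelian G))
  (H3 : ~~ odd n0 -> solvable_number (n0 %/ 2))
  (H4 : forall p r, prime p -> odd p -> p %| n0 -> solvable_number ((2 ^ r * n0) %/ p)%N) :
  forall r, 1 <= r ->
  ~ exists (gT nT : finGroupType) (G : {group gT}),
      [/\ #|G| = (2 ^ r * n0)%N, #|nT| = (2 ^ r * n0)%N, ~~ solvable G, solvable [set: nT]
        & Eprime_nonempty nT G].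
Proof.
have ps_pr : all prime ps by apply: sub_all Hps => p /andP[].
have prod_gt0 : (0 < \prod_(p <- ps) p)%N.
  by rewrite big_seq; apply: prodn_cond_gt0 => p /(allP ps_pr)/prime_gt0.
have n0_gt0 : (0 < n0)%N by rewrite Hn0 !muln_gt0 !expn_gt0.
(* This bounds the rank of [N / M] when [p] is odd. *)
have logn_le p : prime p -> odd p -> logn p n0 <= (if p == 3 then 2 else 1)%N.
  move=> p_pr odd_p; rewrite Hn0 !lognM ?muln_gt0 ?expn_gt0 // !lognX.
  rewrite logn_prod_uniq // !logn_prime //.
  have -> : (p == 2) = false by apply: contraTF odd_p => /eqP->.
  rewrite muln0 add0n; have [-> | _] := eqVneq p 3.
    rewrite muln1; suff /negPf-> : 3 \notin ps by rewrite addn0.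
    by apply: contraL (isT : ~~ (5 <= 3)) => /(allP Hps)/andP[].
  by rewrite muln0; case: (p \in ps).
(* Stating the claim for regular pairs inside any group lets the induction pass to [M], [A] and
   [Y]. *)
have sol_regular r : forall (gT : finGroupType) (N A X : {group gT}),
  regular_pair N A X -> solvable N -> #|N| = (2 ^ r * n0)%N -> solvable X.
- elim/ltn_ind: r => r IHr gT N A X rNAX solN oN; apply: contraT => nsolX.
  have oX := regular_pair_card rNAX.
  case: (posnP r) => [r0' | r_gt0].
    have oN0 : #|N| = n0 by rewrite oN r0' mul1n.
    case: Hbase; exists gT, (subg_of N : finGroupType), X; split=> //.
    - by rewrite oX.
    - by rewrite -cardsT -(card_isog (isog_subg N)).
    - by rewrite -(isog_sol (isog_subg N)).
    exact: regular_pair_Eprime rNAX.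
  have ntN : N :!=: 1.
    by rewrite -cardG_gt1 oN -(prednK r_gt0) expnS -mulnA leq_pmulr // muln_gt0 expn_gt0.
  have [M [p [m [chM p_pr abNM oNM]]]] := max_char_abelem solN ntN.
  have sMN := char_sub chM.
  have oNeq : #|N| = (#|M| * p ^ m.+1)%N.
    by rewrite -oNM card_quotient ?char_norm // Lagrange.
  have rY := regular_pair_char chM rNAX; have oY := regular_pair_card rY.
  set Y := (X :&: _)%G in rY oY.
  have sYX : Y \subset X by apply: subsetIl.
  have iXY : #|X : Y| = (p ^ m.+1)%N.
    by rewrite -divgS // oX oY oNeq mulKn.
  have ltYX : (#|Y| < #|X|)%N.
    by rewrite oY oX oNeq ltn_Pmulr // -{1}(exp1n m.+1) ltn_exp2r // prime_gt1.
  have dvdY : #|Y| %| (2 ^ r * n0)%N by rewrite -oN -oX cardSg.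
  have solY : solvable Y.
    apply: contraT => nsolY.
    have [s le_sr oYs] := insolvable_card_dvd n0_gt0 H3 H4 dvdY nsolY.
    have lt_sr : (s < r)%N.
      by move: ltYX; rewrite oYs oX oN ltn_pmul2r // ltn_exp2l.
    case/negP: nsolY; apply: (IHr s lt_sr _ M A Y) => //; last by rewrite -oY.
    exact: solvableS solN.
  have [p2 | odd_p] := even_prime p_pr.
    have := insolvable_two_power_index n0_gt0 H1 H2 H3 H4 r gT X Y.
    rewrite solY; apply=> //; first by rewrite oX.
    by rewrite iXY p2 pnatX.
  (* The index [p ^ m.+1] divides [2 ^ r * n0] and is prime to [2 ^ r]. *)
  have lgp : m.+1 <= logn p n0.
    rewrite -pfactor_dvdn // -(@Gauss_dvdr _ (2 ^ r)) -?oN ?oNeq ?dvdn_mull //.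
    by rewrite coprimeXl // coprimeXr // coprime_sym coprime2n.
  have nMX : X / M \subset 'N(N / M).
    have [nNA _ _ defXA] := rNAX; apply: quotient_norms.
    apply: (@subset_trans _ _ (N * A)); first by rewrite -defXA mulG_subl.
    by rewrite mul_subG ?normG.
  case/negP: nsolX; apply: regular_pair_sol chM (abelem_abelian abNM) rNAX solY _.
  (* Either [N / M] has prime order and its automorphism group is abelian, or [p = 3] and its order
     is 9. *)
  have := leq_trans lgp (logn_le p p_pr odd_p); case: eqP => [p3 | _] le_m.
    case: m le_m oNM {lgp oNeq iXY} => [|[|//]] _ oNM.
      by apply: sol_quotient_cent_cyclic nMX; rewrite prime_cyclic // oNM expn1.
    by apply: sol_quotient_cent_9 nMX; [rewrite -p3 | rewrite oNM p3].
  case: m le_m oNM {lgp oNeq iXY} => [|//] _ oNM.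
  by apply: sol_quotient_cent_cyclic nMX; rewrite prime_cyclic // oNM expn1.
move=> r _ [gT [nT [G [oG onT nsolG solnT]]]].
case/Eprime_regular_pair=> N [A [X [rNAX isoN isoG]]].
case/negP: nsolG; rewrite (isog_sol isoG).
apply: (sol_regular r _ N A) => //; first by rewrite -(isog_sol isoN).
by rewrite -(card_isog isoN) cardsT.
Qed.
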